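(* Let $\gamma=(\gamma_s)_{s=1}^\infty$ be a sequence of positive numbers with $\gamma_k\le 1/32$ for all $k\in\mathbb N$ and $\sum_{k=1}^\infty\gamma_k<\infty$, and let $K(\gamma)$ and $Y_{s-1}$ be as defined in the context. Then the sequence $(\Lambda_{2^s}(Y_{s-1},K(\gamma)))_{s=1}^\infty$ is bounded.
   Context: Given $\gamma=(\gamma_s)_{s\ge1}$ with $0<\gamma_s<1/4$, let $r_0=1$ and $r_s=\gamma_s r_{s-1}^2$ for $s\in\mathbb N$. Define $P_2(x)=x(x-1)$ and $P_{2^{s+1}}=P_{2^s}(P_{2^s}+r_s)$ for $s\in\mathbb N$. For $s\ge 0$ let $E_s=\{x\in\mathbb R: P_{2^{s+1}}(x)\le 0\}$; thus $E_0=[0,1]$, and $E_s=\bigcup_{j=1}^{2^s}I_{j,s}$ is a disjoint union of $2^s$ closed intervals (basic intervals of level $s$). Put $K(\gamma)=\bigcap_{s=0}^\infty E_s$. For $s\ge1$, $Y_{s-1}$ denotes the set of the $2^s$ endpoints of the intervals $I_{j,s-1}$, $1\le j\le 2^{s-1}$ (equivalently, the set of zeros of $P_{2^s}$). Lebesgue constant: for a set $Z=\{x_1,\dots,x_N\}$ of $N$ distinct points of a compact set $K\subset\mathbb R$, let $l_k(x)=\prod_{i\ne k}\frac{x-x_i}{x_k-x_i}$ ($1\le k\le N$) and $\Lambda_N(Z,K)=\sup_{x\in K}\sum_{k=1}^N|l_k(x)|$. *)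

(* Defs.v *)
From mathcomp Require Import all_boot all_order all_algebra.
From mathcomp Require Import all_classical all_reals all_analysis.
Set Implicit Arguments.
Unset Strict Implicit.
Unset Printing Implicit Defensive.
Import Order.TTheory GRing.Theory Num.Theory.
Import numFieldNormedType.Exports.
Local Open Scope classical_set_scope.
Local Open Scope ring_scope.

(* A sequence (gamma_s)_{s >= 1} is a function on nat whose value at 0 is never
   used. *)
Fixpoint rseq (R : realType) (gamma : nat -> R) (s : nat) : R :=
  if s is t.+1 then gamma s * rseq gamma t ^+ 2 else 1.

(* Ppoly gamma s is P_{2^(s+1)}: the index is shifted because the recursion
   starts at P_2. *)
Fixpoint Ppoly (R : realType) (gamma : nat -> R) (s : nat) : {poly R} :=
  if s is t.+1 then Ppoly gamma t * (Ppoly gamma t + (rseq gamma s)%:P)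
  else 'X * ('X - 1).

Definition Eset (R : realType) (gamma : nat -> R) (s : nat) : set R :=
  [set x | (Ppoly gamma s).[x] <= 0].

Definition Kset (R : realType) (gamma : nat -> R) : set R :=
  \bigcap_(s in [set: nat]) Eset gamma s.

(* The disjoint closed intervals I_{j,s} making up E_s are its connected
   components; connected_component A x is empty when x is not in A, hence the
   condition on x. *)
Definition basic_interval (R : realType) (gamma : nat -> R) (s : nat)
    (a b : R) : Prop :=
  exists2 x, Eset gamma s x & connected_component (Eset gamma s) x = [set` `[a, b]].

Definition Yset (R : realType) (gamma : nat -> R) (s : nat) : set R :=
  [set y | exists a b, basic_interval gamma s a b /\ (y = a \/ y = b)].

(* For a finite set of nodes Z; the node x_k is represented by its value k. *)
Definition lagrange_basis (R : realType) (Z : set R) (k x : R) : R :=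
  \big[*%R/1]_(i \in Z `\ k) ((x - i) / (k - i)).

(* The supremum is taken in the extended reals, so that it is +oo when the
   Lebesgue function is unbounded on K.  N is the cardinality of Z. *)
Definition lebesgue_constant (R : realType) (Z K : set R) : \bar R :=
  ereal_sup [set (\sum_(k \in Z) `|lagrange_basis Z k x|)%:E | x in K].

(* Main.v *)
Require Import Defs.
From mathcomp Require Import all_boot all_order all_algebra.
From mathcomp Require Import ring lra.
From mathcomp Require Import all_classical all_reals all_analysis.
Import Order.TTheory GRing.Theory Num.Theory.
Import numFieldNormedType.Exports.
Local Open Scope classical_set_scope.
Local Open Scope ring_scope.

(** A polynomial q (q + rho) - c factors as (q - w1)(q - w2) with
    w1 + w2 = - rho and w1 w2 = - c, so its nodes are those of q - w1 together
    with those of q - w2, and the Lagrange polynomials of the former are those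
    of q - w1 multiplied by (q - w2)/(w1 - w2).  Hence the Lebesgue function at
    x is at most max(L1(x), L2(x)) (|z - w1| + |z - w2|) / |w1 - w2| with
    z = q(x).  For x in K(gamma) and - r_{s+1} <= c <= 0 the last quotient is at
    most (1 - 4 gamma_{s+1})^(-1/2) <= 1 + 8 gamma_{s+1}, and iterating from
    q = X bounds all the Lebesgue constants by
    prod_k (1 + 8 gamma_k) <= exp (8 sum_k gamma_k). *)

(** * Lebesgue functions of a union of two level sets *)

Section LebesgueFunction.
Variable F : numFieldType.

Definition lagrange_seq (S : seq F) (k x : F) : F :=
  \prod_(i <- S | i != k) ((x - i) / (k - i)).

Definition lebesgue_fun (S : seq F) (x : F) : F :=
  \sum_(k <- S) `|lagrange_seq S k x|.

(** At a node [k] of [S1] the value of [q] is [w1], so the factors from [S2] multiply to [q - w2] at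
    [x] divided by its value [w1 - w2] at [k]. As [w1 != w2], [k] is not in [S2], and the condition
    [i != k] removes nothing there. *)
Lemma lagrange_seq_cat (S1 S2 : seq F) (q : {poly F}) (w1 w2 x k : F) :
  w1 != w2 -> q - w1%:P = \prod_(y <- S1) ('X - y%:P) ->
  q - w2%:P = \prod_(y <- S2) ('X - y%:P) -> k \in S1 ->
  lagrange_seq (S1 ++ S2) k x =
  lagrange_seq S1 k x * ((q.[x] - w2) / (w1 - w2)).
Proof.
move=> w12 q1 q2 kS1.
have qk : q.[k] = w1.
  apply/eqP; rewrite -subr_eq0 -[w1](hornerC _ k) -hornerN -hornerD q1.
  by rewrite -[_ == 0]/(root _ k) root_prod_XsubC.
have kS2 i : i \in S2 -> i != k.
  move=> iS2; apply: contra w12 => /eqP ik.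
  rewrite -subr_eq0 -qk -[w2](hornerC _ k) -hornerN -hornerD q2.
  by rewrite -[_ == 0]/(root _ k) root_prod_XsubC -ik.
have q2E y : q.[y] - w2 = \prod_(i <- S2) (y - i).
  rewrite -[w2](hornerC _ y) -hornerN -hornerD q2 horner_prod.
  by apply: eq_bigr => i _; rewrite !hornerE.
rewrite /lagrange_seq big_cat /=; congr (_ * _).
rewrite -qk !q2E -prodf_div big_seq_cond [RHS]big_seq_cond.
by apply: eq_bigl => i; case: (boolP (i \in S2)) => // /kS2 ->.
Qed.

Lemma lebesgue_fun_cat (S1 S2 : seq F) (q : {poly F}) (w1 w2 x : F) :
  w1 != w2 -> q - w1%:P = \prod_(y <- S1) ('X - y%:P) ->
  q - w2%:P = \prod_(y <- S2) ('X - y%:P) ->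
  lebesgue_fun (S1 ++ S2) x =
  (lebesgue_fun S1 x * `|q.[x] - w2| + lebesgue_fun S2 x * `|q.[x] - w1|)
    / `|w1 - w2|.
Proof.
move=> w12 q1 q2; rewrite /lebesgue_fun big_cat /= mulrDl -!mulrA.
rewrite -[in X in _ = _ + X](distrC w2 w1) -!normf_div !mulr_suml.
congr (_ + _); rewrite !big_seq; apply: eq_bigr => k kS; rewrite -normrM.
  by rewrite (lagrange_seq_cat _ _ _ _ _ _ _ w12 q1 q2).
rewrite -(lagrange_seq_cat _ _ _ _ _ _ _ _ q2 q1) 1?eq_sym //.
by congr (Num.norm _); apply: perm_big; rewrite perm_catC.
Qed.

End LebesgueFunction.

(** * The estimate for one quadratic step *)

Section QuadraticStep.
Variable R : rcfType.

Lemma quadratic_roots (g rho c : R) : 0 < g <= 1 / 32 -> rho != 0 ->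
  - g * rho ^+ 2 <= c <= 0 ->
  exists w1 w2, [/\ w1 != w2, w1 + w2 = - rho, w1 * w2 = - c &
    forall z, z * (z + rho) <= 0 ->
      `|z - w2| + `|z - w1| <= (1 + 8 * g) * `|w1 - w2| ].
Proof.
move=> g0 rho0 c0.
have rho2 : 0 < rho ^+ 2 by rewrite exprn_even_gt0.
pose d := Num.sqrt (rho ^+ 2 + 4 * c).
have d2 : d ^+ 2 = rho ^+ 2 + 4 * c by rewrite sqr_sqrtr //; nra.
have d0 : 0 < d by rewrite sqrtr_gt0; nra.
have dle : `|rho| <= (1 + 8 * g) * d.
  rewrite -(@ler_pXn2r _ 2) // ?nnegrE ?mulr_ge0 //; try lra.
  rewrite real_normK ?num_real // exprMn d2.
  (* [(1 + 8 g)^2 (1 - 4 g) = 1 + 12 g - 256 g^3], which is at least 1 for [0 < g <= 1/32]. *)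
  have : rho ^+ 2 * 1 <= rho ^+ 2 * ((1 + 8 * g) ^+ 2 * (1 - 4 * g)).
    by rewrite ler_pM2l //; nra.
  have : (1 + 8 * g) ^+ 2 * (- g * rho ^+ 2) <= (1 + 8 * g) ^+ 2 * c.
    by rewrite ler_wpM2l ?sqr_ge0 //; lra.
  nra.
exists ((- rho + d) / 2), ((- rho - d) / 2); split.
- by rewrite -subr_eq0 (_ : _ - _ = d) ?gt_eqF //; field.
- by field.
- have -> : (- rho + d) / 2 * ((- rho - d) / 2) = (rho ^+ 2 - d ^+ 2) / 4.
    by field.
  by rewrite d2; field.
move=> z zle.
have -> : (- rho + d) / 2 - (- rho - d) / 2 = d by field.
rewrite (gtr0_norm d0).
(* [(2 z + rho)^2 = rho^2 + 4 z (z + rho)]. *)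
have hz : `|2 * z + rho| <= `|rho|.
  rewrite -(@ler_pXn2r _ 2) // ?nnegrE // !real_normK ?num_real //; nra.
(* The sum of the distances from [z] to the two roots is the larger of [d] and [|2 z + rho|]. *)
have d1 : d <= (1 + 8 * g) * d by nra.
have h1 : 2 * z + rho <= (1 + 8 * g) * d.
  exact: le_trans (ler_norm _) (le_trans hz dle).
have h2 : - (2 * z + rho) <= (1 + 8 * g) * d.
  by apply: le_trans (le_trans hz dle); rewrite -normrN ler_norm.
move: h1 h2 d1; set e := (_ * d) => h1 h2 d1.
by case: ger0P => ?; case: ger0P => ?; lra.
Qed.

End QuadraticStep.

(** The property carried through the induction. The level [c] is a parameter because the zeros of
    [q (q + rho) - c] form two level sets of [q], in general at nonzero levels. *)
Definition lebesgue_nodes {R : realType} (A : set R) (B : R) (q : {poly R})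
    (c : R) : Prop :=
  exists S : seq R, [/\ uniq S, q - c%:P = \prod_(y <- S) ('X - y%:P) &
    forall x, A x -> lebesgue_fun R S x <= B].

Lemma lebesgue_nodesX {R : realType} (A : set R) (c : R) :
  lebesgue_nodes A 1 'X c.
Proof.
exists [:: c]; split=> // [|x _]; first by rewrite big_seq1.
by rewrite /lebesgue_fun big_seq1 /lagrange_seq big_seq_cond big1 ?normr1 //
  => i /andP[]; rewrite inE => ->.
Qed.

Lemma lebesgue_nodes_step {R : realType} (A : set R) (B g rho c : R)
    (q : {poly R}) :
  0 < g <= 1 / 32 -> rho != 0 -> - g * rho ^+ 2 <= c <= 0 ->
  (forall x, A x -> q.[x] * (q.[x] + rho) <= 0) ->
  (forall w, w * (w + rho) = c -> lebesgue_nodes A B q w) ->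
  lebesgue_nodes A (B * (1 + 8 * g)) (q * (q + rho%:P)) c.
Proof.
move=> g0 rho0 c0 Aq nodes.
have [w1 [w2 [w12 sw pw dist]]] := quadratic_roots R g rho c g0 rho0 c0.
have rhoE : rho = - (w1 + w2) by rewrite sw opprK.
have cE : c = - (w1 * w2) by rewrite pw opprK.
have [|S1 [u1 q1 L1]] := nodes w1; first by rewrite rhoE cE; ring.
have [|S2 [u2 q2 L2]] := nodes w2; first by rewrite rhoE cE; ring.
exists (S1 ++ S2); split.
(* At a common node [q] would take both values [w1] and [w2]. *)
- rewrite cat_uniq u1 u2 andbT /=; apply/hasPn => y yS2.
  apply: contra w12 => yS1.
  have /eqP e1 : (q - w1%:P).[y] == 0.
    by rewrite q1 -[_ == 0]/(root _ y) root_prod_XsubC.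
  have /eqP e2 : (q - w2%:P).[y] == 0.
    by rewrite q2 -[_ == 0]/(root _ y) root_prod_XsubC.
  by move: e1 e2; rewrite !hornerE => e1 e2; apply/eqP; lra.
- rewrite big_cat /= -q1 -q2 rhoE cE !(polyCN, polyCD, polyCM); ring.
move=> x Ax; rewrite (lebesgue_fun_cat _ _ _ _ _ _ x w12 q1 q2).
rewrite ler_pdivrMr ?normr_gt0 ?subr_eq0 //.
have B0 : 0 <= B.
  by apply: le_trans (L1 x Ax); apply: sumr_ge0.
apply: (@le_trans _ _ (B * (`|q.[x] - w2| + `|q.[x] - w1|))).
  by rewrite mulrDr lerD // ler_wpM2r // ?L1 ?L2.
by rewrite -mulrA ler_wpM2l // dist // Aq.
Qed.

(** * Endpoints of the components of a polynomial sublevel set *)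

Section Topology.
Variable R : realType.

Lemma compact_component_segment (A : set R) (y : R) : compact A -> A y ->
  exists a b, connected_component A y = [set` `[a, b]].
Proof.
move=> cA Ay; set C := connected_component A y.
have Cy : C y by exact: connected_component_refl.
have cC : compact C.
  apply: (subclosed_compact _ cA); last exact: connected_component_sub.
  by apply: component_closed; apply: compact_closed => //; exact: Rhausdorff.
have C0 : C !=set0 by exists y.
have cid : {within C, continuous (@idfun R)}.
  by apply: continuous_subspaceT => x; exact: cvg_id.
have [b bC bmax] := compact_EVT_max C0 cC cid.
have [a aC amin] := compact_EVT_min C0 cC cid.
exists a, b; apply/seteqP; split=> z /= zC.
  by rewrite in_itv /= amin ?bmax // inE.
have /connected_intervalP iC : connected C by exact: component_connected.
by apply: (iC a b (set_mem aC) (set_mem bC)); move: zC; rewrite in_itv.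
Qed.

(** This rules out endpoints where [p] is negative: the component would continue past them. *)
Lemma neg_horner_component (p : {poly R}) (x y : R) :
  connected_component [set z | p.[z] <= 0] x y -> p.[y] < 0 ->
  exists2 e, 0 < e &
    [set` `[y - e, y + e]] `<=` connected_component [set z | p.[z] <= 0] x.
Proof.
move=> Cxy py.
have : \forall z \near y, p.[z] < 0.
  exact: (@continuous_horner R p y [set t | t < 0] (lt_nbhsl py)).
move=> /nbhs_ballP[e /= e0 pe].
exists (e / 2); first by rewrite divr_gt0.
rewrite (same_connected_component Cxy).
apply: connected_component_max => [|z /=|]; last exact: segment_connected.
- by rewrite /= in_itv /=; apply/andP; split; lra.
- rewrite in_itv /= => /andP[z1 z2]; apply/ltW/pe.
  by rewrite /ball /= ltr_norml; apply/andP; split; lra.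
Qed.

(** An endpoint is a zero, since a component extends past any point where [p < 0]. A zero is an
    endpoint of its own component, since a zero in the interior could not be simple. *)
Lemma component_endpoints_roots (p : {poly R}) (S : seq R) :
  uniq S -> p = \prod_(y <- S) ('X - y%:P) -> compact [set x | p.[x] <= 0] ->
  [set y | exists a b, (exists2 x, p.[x] <= 0 &
     connected_component [set z | p.[z] <= 0] x = [set` `[a, b]]) /\
     (y = a \/ y = b)] = [set` S].
Proof.
move=> uS pE cA; apply/seteqP; split=> y /=.
  move=> [a [b [[x px Cx] yab]]].
  have : connected_component [set z | p.[z] <= 0] x x.
    exact: connected_component_refl.
  rewrite Cx /= in_itv /= => /andP[ax xb].
  have Cy : connected_component [set z | p.[z] <= 0] x y.
    by rewrite Cx /= in_itv /=; case: yab => ->; apply/andP; split=> //; lra.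
  have : p.[y] <= 0 by have := connected_component_sub Cy.
  rewrite le_eqVlt => /orP[|py]; first by rewrite pE -root_prod_XsubC.
  have [e e0] := neg_horner_component p x y Cy py; rewrite Cx => sub.
  have := sub (y - e); have := sub (y + e); rewrite /= !in_itv /= => s1 s2.
  suff : e <= 0 by rewrite leNgt e0.
  case: yab => yE.
    have /andP[? _] : a <= y - e <= b by apply: s2; apply/andP; split; lra.
    lra.
  have /andP[_ ?] : a <= y + e <= b by apply: s1; apply/andP; split; lra.
  lra.
move=> yS.
have py : p.[y] = 0.
  by apply/eqP; rewrite pE -[_ == 0]/(root _ y) root_prod_XsubC.
have Ay : p.[y] <= 0 by rewrite py.
have [a [b Cab]] := compact_component_segment _ y cA Ay.
exists a, b; split; first by exists y.
have : connected_component [set z | p.[z] <= 0] y y.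
  exact: connected_component_refl.
rewrite Cab /= in_itv /= !le_eqVlt => /andP[/orP[/eqP|ay]]; first by left.
move=> /orP[/eqP|yb]; first by right.
have ab : a <= b by exact: ltW (lt_trans ay yb).
(* An interior zero would be a local maximum of [p], hence a double root. *)
have : is_derive y (1 : R) (horner p) 0.
  apply: (derive1_at_max ab) => [t _||t]; first exact: derivable_horner.
    by rewrite in_itv /= ay.
  rewrite in_itv /= py => /andP[ta tb].
  suff : connected_component [set z | p.[z] <= 0] y t.
    by move/connected_component_sub.
  by rewrite Cab /= in_itv /= !ltW.
move=> /(@derive_val _ _ _ _ _ _ _); rewrite derive_val => /eqP.
(* With [p = (X - y) u], the derivative at [y] is [u(y)]; its vanishing would make [y] occur twice
   in [S]. *)
rewrite pE (perm_big _ (perm_to_rem yS)) big_cons /= derivM derivXsubC.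
rewrite !hornerE subrr mul0r addr0 -[_ == 0]/(root _ y) root_prod_XsubC.
by rewrite mem_rem_uniq // !inE eqxx.
Qed.

End Topology.

(** * Application to the polynomials defining [K(gamma)] *)

Section KGamma.
Variables (R : realType) (gamma : nat -> R).
Hypothesis gamma_gt0 : forall k : nat, (1 <= k)%N -> 0 < gamma k.
Hypothesis gamma_le : forall k : nat, (1 <= k)%N -> gamma k <= 1 / 32.

Lemma rseq_gt0 (s : nat) : 0 < rseq gamma s.
Proof. by elim: s => //= s IH; rewrite mulr_gt0 ?exprn_gt0 ?gamma_gt0. Qed.

(** The node sets of the theorem are the case [c = 0]; the induction requires a range of levels that
    is stable under passing from [c] to the roots of [w (w + r) = c]. *)
Lemma Ppoly_nodes (t : nat) (c : R) : - rseq gamma t.+1 <= c <= 0 ->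
  lebesgue_nodes (Kset gamma) (\prod_(1 <= i < t.+2) (1 + 8 * gamma i))
    (Ppoly gamma t) c.
Proof.
have gt s : 0 < gamma s.+1 <= 1 / 32 by rewrite gamma_gt0 ?gamma_le.
elim: t c => [|t IH] c /andP[c1 c2].
  (* [P_2 = X (X - 1)] is itself a quadratic step, with [q = X], [rho = -1] and initial bound 1. *)
  rewrite big_nat1 -[1 + _]mul1r /= -polyC1 -polyCN.
  apply: lebesgue_nodes_step => //.
  - rewrite c2 andbT; move: c1 => /=.
    by rewrite sqrrN !expr1n mulr1 mulNr mulr1.
  - by move=> x /(_ 0%N I); rewrite /Eset /= !hornerE.
  - by move=> w _; exact: lebesgue_nodesX.
have r0 := rseq_gt0 t.+1.
rewrite big_nat_recr //=; apply: lebesgue_nodes_step => //.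
- by rewrite gt_eqF.
- by rewrite c2 andbT mulNr.
- by move=> x /(_ t.+1 I); rewrite /Eset /= !hornerE.
(* With [r = r_{t+1} > 0], [w (w + r) = c <= 0] forces [-r <= w <= 0]. *)
- by move=> w wc; apply: IH; apply/andP; split; move: wc r0 c2 => /=; nra.
Qed.

(** The sets decrease, as [P (P + r) <= 0] with [r > 0] forces [P <= 0]; so all are closed subsets
    of [E_0 = [0, 1]]. *)
Lemma compact_Eset (s : nat) : compact (Eset gamma s).
Proof.
apply: (subclosed_compact _ (@segment_compact R 0 1)).
  have -> : Eset gamma s = horner (Ppoly gamma s) @^-1` [set y | y <= 0] by [].
  apply: (preimage_closed _ (@closed_le R 0)) => x _.
  exact: continuous_horner.
elim: s => [|s IH] x; rewrite /Eset /=.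
  by rewrite in_itv /= !hornerE => h; apply/andP; split; nra.
rewrite !hornerE => h; apply: IH; rewrite /Eset /=.
by have := rseq_gt0 s.+1; move: h => /=; nra.
Qed.

Lemma prod_expR_le (a b : nat) : (1 <= a)%N ->
  \prod_(a <= i < b) (1 + 8 * gamma i) <= expR (8 * \sum_(a <= i < b) gamma i).
Proof.
move=> a1; rewrite mulr_sumr expR_sum big_nat_cond [leRHS]big_nat_cond.
apply: ler_prod => i /andP[/andP[ai _] _]; rewrite expR_ge1Dx andbT.
by have := gamma_gt0 _ (leq_trans a1 ai); lra.
Qed.

End KGamma.

Lemma lebesgue_constant_seq {R : realType} (S : seq R) (K : set R) :
  uniq S ->
  lebesgue_constant [set` S] K =
  ereal_sup [set (lebesgue_fun R S x)%:E | x in K].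
Proof.
move=> uS; congr ereal_sup; congr image; apply/funext => x; congr EFin.
rewrite -fsbig_seq // /lebesgue_fun big_seq [RHS]big_seq.
apply: eq_bigr => k kS; congr (Num.norm _).
rewrite /lagrange_basis.
have -> : [set` S] `\ k = [set` [seq i <- S | i != k]].
  apply/seteqP; split=> i /=; rewrite mem_filter.
    by move=> [-> /eqP ->].
  by move=> /andP[/eqP ? ->].
by rewrite -fsbig_seq ?filter_uniq // big_filter.
Qed.

Theorem theorem6p3 (R : realType) (gamma : nat -> R)
  (gamma_gt0 : forall k : nat, (1 <= k)%N -> 0 < gamma k)
  (gamma_le : forall k : nat, (1 <= k)%N -> gamma k <= 1 / 32)
  (gamma_summable : (\sum_(1 <= k <oo) (gamma k)%:E < +oo)%E) :
  exists M : R, forall s : nat, (1 <= s)%N ->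
    (lebesgue_constant (Yset gamma s.-1) (Kset gamma) <= M%:E)%E.
Proof.
set T := (\sum_(1 <= k <oo) (gamma k)%:E)%E in gamma_summable *.
have ge0 n : (1 <= n)%N -> xpredT n -> (0 <= (gamma n)%:E)%E.
  by move=> n1 _; rewrite lee_fin ltW // gamma_gt0.
have Tfin : T \is a fin_num by rewrite ge0_fin_numE // nneseries_ge0.
(* The terms are nonnegative, so [T] bounds every partial sum and one constant serves all levels.
   From here [s = t + 1], and [Ppoly gamma t] is [P_{2^s}]. *)
exists (expR (8 * fine T)) => -[//|t] _ /=.
have [|S [uS pE LS]] := Ppoly_nodes R gamma gamma_gt0 gamma_le t 0.
  by rewrite lexx andbT oppr_le0 ltW // rseq_gt0.
rewrite subr0 in pE.
have -> : Yset gamma t = [set` S].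
  exact: component_endpoints_roots uS pE (compact_Eset R gamma gamma_gt0 t).
rewrite lebesgue_constant_seq //; apply: ge_ereal_sup => _ [x Kx <-].
rewrite lee_fin; apply: le_trans (LS x Kx) _.
apply: le_trans (prod_expR_le R gamma gamma_gt0 _ _ _) _ => //.
rewrite ler_expR ler_pM2l // -lee_fin fineK // -sumEFin.
exact: nneseries_lim_ge.
Qed.
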